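(* All three of the subseries numbers $\text{\ss}$, $\text{\ss}_i$ and $\text{\ss}_o$ are uncountable.
   Context: $\mathbb{N}=\{1,2,3,\dots\}$. For $A\subseteq\mathbb{N}$, the subseries $\sum_{n\in A}a_n$ is summed in increasing order of the indices; if $A$ is finite it counts as convergent. A series is conditionally convergent if it converges but not absolutely. A series diverges by oscillation if its partial sums neither converge to a real number nor tend to $+\infty$ nor tend to $-\infty$. The subseries number $\text{\ss}$ is the smallest cardinality of a family $\mathcal{A}$ of subsets of $\mathbb{N}$ such that for every conditionally convergent series $\sum_{n\in\mathbb{N}}a_n$ of real numbers there is $A\in\mathcal{A}$ such that $\sum_{n\in A}a_n$ diverges. $\text{\ss}_i$ (respectively $\text{\ss}_o$) is defined in the same way, except that $\sum_{n\in A}a_n$ is required to diverge to $+\infty$ or to $-\infty$ (respectively, to diverge by oscillation). *)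

(* Defs.v *)
From HB Require Import structures.
From mathcomp Require Import all_boot all_order all_algebra.
From mathcomp Require Import all_classical all_reals all_analysis.

Set Implicit Arguments.
Unset Strict Implicit.
Unset Printing Implicit Defensive.

Import Order.TTheory GRing.Theory Num.Theory.
Import numFieldNormedType.Exports.

Local Open Scope classical_set_scope.
Local Open Scope card_scope.
Local Open Scope ring_scope.

(* Series are indexed by nat = {0, 1, 2, ...} instead of {1, 2, 3, ...}; this
   only shifts the indices and preserves their order. *)

Definition conditionally_convergent (R : realType) (a : R ^nat) : Prop :=
  cvgn (series a) /\ ~ cvgn [normed series a].

(* Partial sums of \sum_(k in A) a_k in increasing order of the indices, cut at
   k < n. This is the sequence of partial sums along the increasing enumeration
   of A, each being repeated finitely often while n runs through a gap of A;
   if A is finite it is eventually constant, hence convergent. *)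
Definition subseries (R : realType) (a : R ^nat) (A : set nat) : R ^nat :=
  fun n => \sum_(0 <= k < n | k \in A) a k.

Definition diverges (R : realType) (s : R ^nat) : Prop := ~ cvgn s.

Definition diverges_to_infinity (R : realType) (s : R ^nat) : Prop :=
  s @ \oo --> +oo \/ s @ \oo --> -oo.

Definition diverges_by_oscillation (R : realType) (s : R ^nat) : Prop :=
  [/\ ~ cvgn s, ~ (s @ \oo --> +oo) & ~ (s @ \oo --> -oo)].

Definition subseries_family (R : realType) (D : R ^nat -> Prop)
    (F : set (set nat)) : Prop :=
  forall a : R ^nat, conditionally_convergent a ->
    exists2 A, F A & D (subseries a A).

Definition smallest_cardinality (T : Type) (C : set (set T)) (F : set T) : Prop :=
  C F /\ forall G, C G -> F #<= G.

(* A cardinal is represented by a set of that cardinality: here, a chosen member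
   of C of smallest cardinality. The default value set0, taken if C has no such
   member, is countable, so that an uncountable min_cardinality C can only
   come from an actual smallest member of C. *)
Definition min_cardinality (T : Type) (C : set (set T)) : set T :=
  xget set0 [set F | smallest_cardinality C F].

Definition subseries_number (R : realType) : set (set nat) :=
  min_cardinality (subseries_family (@diverges R)).

Definition subseries_number_i (R : realType) : set (set nat) :=
  min_cardinality (subseries_family (@diverges_to_infinity R)).

Definition subseries_number_o (R : realType) : set (set nat) :=
  min_cardinality (subseries_family (@diverges_by_oscillation R)).

(* Main.v *)
(* Given countably many sets A_i, some infinite B is almost contained in A_i or
   almost disjoint from it, for each i. A conditionally convergent series that
   vanishes off B then has only convergent subseries along the A_i: each agrees,
   up to finitely many terms, with the whole series or with 0. Hence no countable
   family witnesses any of the three numbers.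
   As min_cardinality defaults to the countable set0, the three numbers must also
   be shown to exist: the family of all sets is a witness (take the nonnegative
   terms, resp. a greedy zigzag), and cardinals are well ordered. *)
Require Import Defs.
From mathcomp Require Import all_boot all_order all_algebra.
From mathcomp Require Import all_classical all_reals all_analysis.
From mathcomp Require Import ring lra.

Import Order.TTheory GRing.Theory Num.Theory.
Import numFieldNormedType.Exports.

Local Open Scope classical_set_scope.
Local Open Scope card_scope.
Local Open Scope ring_scope.

(** * Smallest cardinalities *)

(* Hönig's proof that cardinals are well ordered: take a maximal set S of choice
   functions on C that differ pairwise at every member of C. By maximality some
   G in C is covered by the values of S, so G is at most as large as S, which
   injects into every member of C. *)
Lemma smallest_cardinality_exists (T : Type) (C : set (set T)) :
  C !=set0 -> exists F, smallest_cardinality C F.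
Proof.
move=> [G0 CG0].
pose P (S : set (set T -> T)) :=
  (forall f G, S f -> C G -> G (f G)) /\
  (forall f g G, S f -> S g -> C G -> f G = g G -> f = g).
have [|S [[Sin Sinj] Smax]] := @Zorn_bigcup _ P.
  move=> F FP Ftot; split.
    by move=> f G [X FX Xf]; have [+ _] := FP _ FX; apply.
  move=> f g G [X FX Xf] [Y FY Yg].
  have [XY|YX] := Ftot _ _ FX FY.
    by have [_] := FP _ FY; apply => //; exact: XY.
  by have [_] := FP _ FX; apply => //; exact: YX.
have [[G CG GS]|noG] :=
    pselect (exists2 G, C G & G `<=` (fun f => f G) @` S).
  exists G; split=> // H CH.
  apply: (card_le_trans (subset_card_le GS)).
  apply: (card_le_trans (card_image_le _ _)).
  have Hinj : {in S &, injective (fun f : set T -> T => f H)}.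
    by move=> f g /set_mem Sf /set_mem Sg; exact: Sinj.
  have /card_eqPle[_ SH] := inj_card_eq Hinj.
  apply: (card_le_trans SH); apply: subset_card_le => _ [f Sf <-].
  exact: (Sin f H).
have new G : C G -> exists x, G x /\ ~ ((fun f => f G) @` S) x.
  move=> CG; apply/not_existsP => H; apply: noG; exists G => // x Gx.
  by apply: contrapT => xS; exact: (H x).
have [x0 _] := new _ CG0.
(* This [f] differs from every element of [S] at each member of [C], so [S] could be enlarged by it;
   [x0] is only a default outside [C]. *)
have /choice[f fP] G : exists x, C G -> G x /\ ~ ((fun f => f G) @` S) x.
  by have [/new[x xP]|nCG] := pselect (C G); [exists x | exists x0].
exfalso; have := Smax (S `|` [set f]); apply.
  split; first exact: subsetUl.
  move=> /(_ f (or_intror erefl)) Sf.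
  by have [_ nS] := fP _ CG0; apply: nS; exists f.
split.
  by move=> g G [Sg|->] CG; [exact: (Sin g G)|have [] := fP _ CG].
move=> g h G [Sg|->] [Sh|->] CG // e.
- exact: Sinj e.
- by have [_ []] := fP _ CG; exists g.
- by have [_ []] := fP _ CG; exists h.
Qed.

Lemma min_cardinalityP (T : Type) (C : set (set T)) :
  C !=set0 -> C (min_cardinality C).
Proof.
by move=> /smallest_cardinality_exists/(xgetPex set0)[].
Qed.

(** * Infinite sets not split by countably many sets *)

(* A pseudo-intersection of the members of a nonprincipal ultrafilter among the
   e i and their complements. *)
Lemma countable_unsplit (e : nat -> set nat) :
  exists B : set nat, (forall k, exists2 m, (k <= m)%N & B m) /\
    forall i, (\forall m \near \oo, B m -> e i m) \/
              (\forall m \near \oo, B m -> ~ e i m).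
Proof.
have [U [UU Uoo]] := ultraFilterLemma (F := \oo) _.
pose X i := if pselect (U (e i)) then e i else ~` e i.
have UX i : U (X i).
  rewrite /X; case: pselect => // nU.
  by case: (in_ultra_setVsetC (e i) UU).
have UXs k : U [set m | forall i, (i < k)%N -> X i m].
  elim: k => [|k IH]; first by apply: filterS filterT.
  apply: filterS2 IH (UX k) => m IH Xk i.
  by rewrite ltnS leq_eqVlt => /predU1P[->//|]; exact: IH.
(* Finite intersections of the [X i] and all tails lie in [U], so they meet. *)
have /choice[b bP] k : exists m, (k <= m)%N /\ forall i, (i < k)%N -> X i m.
  have /filter_ex[m [km mX]] : U ([set m | (k <= m)%N] `&`
      [set m | forall i, (i < k)%N -> X i m]).
    by apply: filterI (UXs k); apply: Uoo; exists k.
  by exists m.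
exists (range b); split=> [k|i]; first by exists (b k); [case: (bP k)|exists k].
have : \forall m \near \oo, range b m -> X i m.
  (* Beyond [b 0], ..., [b i], an element of the range is some [b k] with [i < k]. *)
  exists (\max_(k < i.+1) (b k)).+1 => // m /= mi [k _ bk].
  have [_] := bP k; rewrite bk; apply; rewrite ltnNge; apply/negP => ki.
  have := leq_bigmax (F := fun k : 'I_i.+1 => b k) (Ordinal (n := i.+1) ki).
  by rewrite /= bk leqNgt mi.
by rewrite /X; case: pselect => ? /=; [left|right].
Qed.

(** * A subseries tending to infinity *)

Lemma in_setbE (T : Type) (P : pred T) (x : T) : (x \in [set y | P y]) = P x.
Proof. by apply/idP/idP; rewrite inE. Qed.

Section series.
Context {R : realType}.
Implicit Types (a u v : R ^nat) (A B : set nat).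

Lemma near_eq_is_cvg_series u v : (\forall n \near \oo, u n = v n) ->
  cvgn (series u) -> cvgn (series v).
Proof.
move=> [N _ uv]; rewrite -(is_cvg_series_restrict N).
rewrite -(is_cvg_series_restrict N v).
rewrite [X in cvgn X -> _](_ : _ = [sequence \sum_(N <= k < n) v k]_n) //.
apply/funext => n /=.
by apply: eq_big_nat => k /andP[Nk _]; rewrite uv.
Qed.

Lemma subseriesE a A :
  subseries a A = series (fun k => if k \in A then a k else 0).
Proof. by apply/funext => n; rewrite /subseries /series /= big_mkcond. Qed.

Lemma conditionally_convergentN a :
  conditionally_convergent a -> conditionally_convergent (- a).
Proof.
move=> [ca na]; split; first by rewrite is_cvg_seriesN.
rewrite (_ : [normed series (- a)] = [normed series a]) //.
by congr series; apply/funext => n /=; rewrite normrN.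
Qed.

Lemma dvg_series_pos_part a : conditionally_convergent a ->
  series (fun k => Num.max (a k) 0) @ \oo --> +oo.
Proof.
move=> [ca na]; apply: nondecreasing_dvgn_lt.
  by apply: nondecreasing_series => n _ _; rewrite le_max lexx orbT.
(* |x| = 2 max(x, 0) - x *)
move=> cp; apply: na.
pose p := fun k => Num.max (a k) 0.
rewrite (_ : [normed series a] = series (p + p - a)).
  by apply: is_cvg_seriesB => //; exact: is_cvg_seriesD.
congr series; apply/funext => n; rewrite !fctE /p /=.
by have [h|h] := leP 0 (a n); rewrite ?(ger0_norm h) ?(ltr0_norm h); lra.
Qed.

Lemma ex_subseries_pinfty a : conditionally_convergent a ->
  exists A, subseries a A @ \oo --> +oo.
Proof.
move=> ca; exists [set k | 0 <= a k]; rewrite subseriesE.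
rewrite (_ : series _ = series (fun k => Num.max (a k) 0)).
  exact: dvg_series_pos_part.
congr series; apply/funext => k; rewrite in_setbE.
by have [] := leP 0 (a k).
Qed.

(** * An oscillating subseries *)

(* Greedy walk: the terms whose sign is (-1)^b are summed until the sum reaches
   (-1)^b or beyond, then b is flipped. *)
Fixpoint zigzag a (n : nat) : bool * R :=
  if n is m.+1 then
    let: (b, s) := zigzag a m in
    let s' := s + (if 0 <= (-1) ^+ b * a m then a m else 0) in
    (b (+) (1 <= (-1) ^+ b * s'), s')
  else (false, 0).

Lemma zigzagS a n (b := (zigzag a n).1) (s := (zigzag a n.+1).2) :
  s = (zigzag a n).2 + (if 0 <= (-1) ^+ b * a n then a n else 0) /\
  (zigzag a n.+1).1 = b (+) (1 <= (-1) ^+ b * s).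
Proof. by rewrite /s /b /=; case: zigzag. Qed.

(** Without a turn after [N] the walk would add all later terms of one sign; these have an infinite
    sum, so the threshold would be passed. *)
Lemma zigzag_turns a N (b := (zigzag a N).1) : conditionally_convergent a ->
  exists n, [/\ (N <= n)%N, 1 <= (-1) ^+ b * (zigzag a n).2
    & (zigzag a n).1 = ~~ b].
Proof.
move=> ca; apply: contrapT => noturn.
pose p := fun k => Num.max ((-1) ^+ b * a k) 0.
have stay n : (N <= n)%N -> (zigzag a n).1 = b /\
    (-1) ^+ b * (zigzag a n).2 =
    (-1) ^+ b * (zigzag a N).2 + series p n - series p N.
  elim: n => [|n IH].
    by rewrite leqn0 => /eqP N0; rewrite /b N0 addrK.
  rewrite leq_eqVlt => /predU1P[<-|]; first by rewrite addrK.
  rewrite ltnS => Nn; have [b1 s1] := IH Nn.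
  have [s2 b2] := zigzagS a n.
  have lt1 : (1 <= (-1) ^+ b * (zigzag a n.+1).2) = false.
    apply/negP => h; apply: noturn; exists n.+1; split=> //; first exact: leqW.
    by rewrite b2 b1 h addbT.
  split; first by rewrite b2 b1 lt1 addbF.
  rewrite s2 b1 mulrDr s1 (seriesSr p) /p /Num.max.
  by have [h|h] := ltP; rewrite ?mulr0; ring.
have cb : conditionally_convergent (fun k => (-1) ^+ b * a k).
  case: (b); last first.
    by rewrite (_ : (fun k => _) = a) //; apply/funext => k; rewrite mul1r.
  rewrite (_ : (fun k => _) = - a); first exact: conditionally_convergentN.
  by apply/funext => k; rewrite mulN1r.
(* Once [series p] reaches this bound, [stay] puts the walk at distance at least 1 in direction [b],
   which forces a flip. *)
have /cvgryPge/(_ (1 - (-1) ^+ b * (zigzag a N).2 + series p N))[M _ pM] :=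
  dvg_series_pos_part _ cb.
have := pM (maxn M N).+1; rewrite /= leqW ?leq_maxl // => /(_ isT) big.
have Nm : (N <= maxn M N)%N by rewrite leq_maxr.
have [b0 _] := stay _ Nm; have [b1 s1] := stay _ (leqW Nm).
have [_] := zigzagS a (maxn M N); rewrite b1 b0 s1.
rewrite [X in _ (+) X](_ : _ = true); first by case: (b).
by apply/idP; move: big; rewrite -/p; lra.
Qed.

(** Successive turns have opposite directions, so one of the next two is at the side [b]. *)
Lemma zigzag_frequently a (b : bool) N : conditionally_convergent a ->
  exists2 n, (N <= n)%N & 1 <= (-1) ^+ b * (zigzag a n).2.
Proof.
move=> ca; have [n [Nn sn bn]] := zigzag_turns a N ca.
have [m [nm sm _]] := zigzag_turns a n ca.
have [<-|bN] := eqVneq (zigzag a N).1 b; first by exists n.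
exists m; first exact: leq_trans nm.
by move: sm; rewrite bn; case: (b) bN; case: (_.1).
Qed.

(** Any limit, finite or infinite, is below 1 or above -1, and the sequence would eventually stay on
    that side. *)
Lemma oscillates_of_frequently (s : R ^nat) :
  (forall N, exists2 n, (N <= n)%N & 1 <= s n) ->
  (forall N, exists2 n, (N <= n)%N & s n <= -1) ->
  diverges_by_oscillation s.
Proof.
move=> up down.
have ltF : ~ \forall n \near \oo, s n < 1.
  by move=> [N _ sN]; have [n /sN /= ?] := up N; rewrite leNgt => /negP.
have gtF : ~ \forall n \near \oo, -1 < s n.
  by move=> [N _ sN]; have [n /sN /= ?] := down N; rewrite leNgt => /negP.
split.
- move=> /cvg_ex[l sl]; have [l1|l1] := ltP l 1.
    by apply: ltF; exact: cvgr_lt sl _ l1.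
  by apply: gtF; apply: (cvgr_gt _ sl); lra.
- by move=> /cvgryPgt/(_ (-1)).
- by move=> /cvgrNyPlt/(_ 1).
Qed.

Lemma ex_subseries_oscillation a : conditionally_convergent a ->
  exists A, diverges_by_oscillation (subseries a A).
Proof.
move=> ca; exists [set n | 0 <= (-1) ^+ (zigzag a n).1 * a n].
rewrite subseriesE (_ : series _ = fun n => (zigzag a n).2).
  apply: oscillates_of_frequently => N.
    by have [n Nn] := zigzag_frequently a false N ca; rewrite mul1r; exists n.
  have [n Nn] := zigzag_frequently a true N ca; rewrite mulN1r => h.
  by exists n => //; lra.
apply/funext; elim=> [|n IH]; first by rewrite /series /= big_geq.
by have [-> _] := zigzagS a n; rewrite seriesSr IH in_setbE.
Qed.

(** * A conditionally convergent series on a given infinite set *)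

(* a is the telescope of the sequence 0, 1/2, 0, 1/4, 0, 1/6, ... slowed down so
   that it moves only at the elements of B. *)
Lemma conditionally_convergent_on B : (forall k, exists2 m, (k <= m)%N & B m) ->
  exists2 a : R ^nat, conditionally_convergent a & forall m, ~ B m -> a m = 0.
Proof.
move=> Binf.
pose c n := (\sum_(0 <= k < n) (k \in B : nat))%N.
have cS n : c n.+1 = (c n + (n \in B))%N by rewrite /c big_nat_recr.
have c_ge k : \forall n \near \oo, (k <= c n)%N.
  elim: k => [|k [N _ IH]]; first exact: nearW.
  have [m Nm Bm] := Binf N; exists m.+1 => // n /= mn.
  have cm : (k < c m.+1)%N by rewrite cS mem_set // addn1 ltnS; exact: IH.
  apply: (leq_trans cm); rewrite /c (big_cat_nat (leq0n _) mn) /=.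
  exact: leq_addr.
pose t n : R := (odd n)%:R * harmonic n.
have t_cvg : t @ \oo --> 0.
  apply: (squeeze_cvgr _ (cvg_cst 0) (@cvg_harmonic R)); apply: nearW => n.
  by rewrite /t; case: odd; rewrite ?mul0r ?mul1r ?lexx harmonic_ge0.
have t_dist k : harmonic k.+1 <= `|t k.+1 - t k|.
  rewrite /t /=; case: odd => /=; last first.
    by rewrite mul0r subr0 mul1r ger0_norm ?harmonic_ge0.
  rewrite mul0r sub0r normrN mul1r ger0_norm ?harmonic_ge0 //.
  by rewrite /harmonic /= lef_pV2 ?posrE ?ltr0n // ler_nat.
exists (telescope (t \o c)).
  split.
    rewrite telescopeK; apply: is_cvgB; last exact: is_cvg_cst.
    apply/cvg_ex; exists 0; apply: cvg_comp t_cvg.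
    by apply/cvgnyPge => k; exact: c_ge.
  move=> cn.
  (* The [c n] moves made before [n] have lengths at least [harmonic 1], ..., [harmonic (c n)];
     subtracting 1 removes [harmonic 0]. *)
  have le_norm n : series harmonic (c n).+1 - 1 <=
      [normed series (telescope (t \o c))] n.
    elim: n => [|n IH].
      have c0 : c 0%N = 0%N by rewrite /c big_geq.
      rewrite c0 seriesEnat /= big_nat1 /= invr1 subrr.
      by rewrite seriesEnat /= big_geq.
    rewrite [leRHS]seriesSr cS; case En: (n \in B); last first.
      by rewrite addn0 ler_wpDr /= ?normr_ge0.
    rewrite addn1 seriesSr addrAC lerD //= /telescope /= cS En addn1.
    exact: t_dist.
  apply: (@dvg_harmonic R); apply: nondecreasing_is_cvgn.
    by apply: nondecreasing_series => n _ _; exact: harmonic_ge0.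
  (* As [c] is unbounded, this bounds every harmonic partial sum. *)
  exists (limn [normed series (telescope (t \o c))] + 1) => _ [k _ <-].
  have [n _ /(_ n (leqnn n)) kn] := c_ge k.
  rewrite -lerBlDr.
  apply: (@le_trans _ _ ([normed series (telescope (t \o c))] n)).
    apply: le_trans (le_norm n); rewrite lerD2r.
    apply: (nondecreasing_series (P := xpredT)) => [i _ _|].
      exact: harmonic_ge0.
    exact: leqW.
  apply: (nondecreasing_cvgn_le _ cn).
  by apply: nondecreasing_series => i _ _; exact: normr_ge0.
by move=> m Bm; rewrite /telescope /= cS memNset // addn0 subrr.
Qed.

(** * Uncountability *)

Lemma countable_subseries_cvg (F : set (set nat)) : countable F ->
  exists2 a : R ^nat, conditionally_convergent a &
    forall A, F A -> cvgn (subseries a A).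
Proof.
move=> /pcard_surjP[e Fe].
have [B [Binf Be]] := countable_unsplit e.
have [a ca a0] := conditionally_convergent_on B Binf.
exists a => // A FA; have [i _ eA] := Fe _ FA; rewrite subseriesE -eA.
have [Bi|Bi] := Be i.
  apply: near_eq_is_cvg_series ca.1; apply: filterS Bi => m Bm.
  by case: ifPn => // ei; apply: a0 => /Bm/mem_set; exact/negP.
apply: (@near_eq_is_cvg_series (fun=> 0)); last first.
  rewrite (_ : series _ = cst 0); first exact: is_cvg_cst.
  by apply/funext => n; rewrite /series /= big1.
apply: filterS Bi => m Bm.
by case: ifPn => // /set_mem ei; rewrite a0 // => /Bm.
Qed.

(** The second hypothesis makes the family of all sets a witness, so the minimum is attained by an
    actual witness. *)
Lemma uncountable_min_cardinality (D : R ^nat -> Prop) :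
  (forall s, D s -> ~ cvgn s) ->
  (forall a, conditionally_convergent a -> exists A, D (subseries a A)) ->
  ~ countable (min_cardinality (subseries_family D)).
Proof.
move=> Ddiv Dex /countable_subseries_cvg[a ca acvg].
have /min_cardinalityP/(_ a ca)[A /acvg cA /Ddiv//] :
  subseries_family D !=set0.
by exists setT => u /Dex[A DA]; exists A.
Qed.

Lemma diverges_to_infinity_dvg (s : R ^nat) :
  diverges_to_infinity s -> ~ cvgn s.
Proof.
move=> soo /cvg_ex[l sl].
have lt_s : \forall n \near \oo, s n < l + 1 by apply: (cvgr_lt _ sl); lra.
have gt_s : \forall n \near \oo, l - 1 < s n by apply: (cvgr_gt _ sl); lra.
case: soo => [/cvgryPge/(_ (l + 1)) ge_s|/cvgrNyPle/(_ (l - 1)) le_s].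
- by have [n [/lt_geF ->]] := filter_ex (filterI lt_s ge_s).
- by have [n [/lt_geF ->]] := filter_ex (filterI gt_s le_s).
Qed.

End series.

Theorem corollary8 (R : realType) :
  [/\ ~ countable (subseries_number R),
      ~ countable (subseries_number_i R) &
      ~ countable (subseries_number_o R)].
Proof.
split; apply: uncountable_min_cardinality => //.
- by move=> a /ex_subseries_oscillation[A []]; exists A.
- exact: diverges_to_infinity_dvg.
- by move=> a /ex_subseries_pinfty[A]; exists A; left.
- by move=> s [].
- exact: ex_subseries_oscillation.
Qed.
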